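(* Let $\mathcal B$ be a separable complex Banach space, let $U\subset\mathbb C$ be open and connected, let $z_0\in U$, and let $A:U\to\mathcal L_{\mathcal B}$ be an analytic function such that $A(z)$ is Fredholm for every $z\in U$, invertible for every $z\in U\setminus\{z_0\}$, and not invertible at $z=z_0$. Let $A_{j,z_0}$, $P_k$, $Q_k$, $A^{[k]}$ and $d>0$ be as in the context, with $A^{[d]}(z_0)$ invertible, and suppose that $P_0=0$, $P_d\ne I$, and $P_{d+j}=I$ for $j>0$. The following conditions are equivalent: (i) $A(z)^{-1}$ has a pole of order $d$ at $z=z_0$. (ii) $A^{[d]}(z_0)$ is invertible while $A^{[d-1]}(z_0)$ is not. (iii) $\mathcal B=\sum_{j=0}^d\operatorname{ran}\big((P_{j+1}-P_j)A_{j,z_0}\big)$ with $P_d\ne I$ and $P_{d+1}=I$. (iv) $\{0\}=\bigcap_{j=0}^d\ker\big((P_{j+1}-P_j)A_{j,z_0}\big)$ with $P_d\ne I$ and $P_{d+1}=I$.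
   Context: $\mathcal L_{\mathcal B}$ is the space of bounded linear operators on $\mathcal B$ and $I$ is the identity. A projection is a bounded idempotent operator. An operator $T\in\mathcal L_{\mathcal B}$ is Fredholm if $\dim(\ker T)<\infty$ and $\dim(\operatorname{coker}T)<\infty$. The operators $A_{j,z_0}\in\mathcal L_{\mathcal B}$ are the Taylor coefficients of $A$ at $z_0$: $A(z)=\sum_{j=0}^\infty A_{j,z_0}(z-z_0)^j$. Successive factorization: starting from $A^{[0]}=A$, for $k=1,2,\ldots$ let $P_k$ be a projection with $\operatorname{ran}P_k=\operatorname{ran}A^{[k-1]}(z_0)$ (no other requirement is imposed on $P_k$; in particular its kernel may be any convenient choice), let $Q_k=I-P_k$, and let $A^{[k]}$, called the Fredholm quotient of order $k$, be the analytic function on $U$, with values Fredholm operators of index zero, satisfying $A^{[k-1]}(z)=(P_k+(z-z_0)Q_k)A^{[k]}(z)$ for $z\in U$ (so $A^{[k]}(z)=(P_k+(z-z_0)^{-1}Q_k)A^{[k-1]}(z)$ for $z\ne z_0$, extended analytically to $z_0$). The integer $d>0$ is such that $A(z)=(P_1+(z-z_0)Q_1)\cdots(P_d+(z-z_0)Q_d)A^{[d]}(z)$ with $A^{[d]}$ analytic and $A^{[d]}(z_0)$ invertible; then $\operatorname{ran}P_1\subset\cdots\subset\operatorname{ran}P_d$.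
   Formalization: The inclusions ran P_1 ⊂ … ⊂ ran P_d, stated as a consequence of the construction, are assumed as a hypothesis: they can fail for the P_k allowed, and the equivalence with (iv) is then false, e.g. A(z)=[[1,0],[z,z²]] at z_0=0 with P_1=[[1,1],[0,0]], P_2=diag(0,1). *)

(* Defs.v *)
From mathcomp Require Import all_boot all_order all_algebra.
From mathcomp Require Import all_classical all_reals all_analysis.
Set Implicit Arguments.
Unset Strict Implicit.
Unset Printing Implicit Defensive.
Import Order.TTheory GRing.Theory Num.Theory.
Import numFieldNormedType.Exports.
Local Open Scope classical_set_scope.
Local Open Scope ring_scope.

(* Operators are compared extensionally, with [=1]. *)
Record bop (K : numFieldType) (B : normedModType K) := Bop {
  bop_fun :> {linear B -> B};
  bop_continuous : continuous bop_fun }.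

Definition separable (T : topologicalType) :=
  exists2 D : set T, countable D & dense D.

Section BoundedOperators.
Variables (K : numFieldType) (B : normedModType K).
Implicit Types (T S P : bop B) (f : K -> bop B) (U : set K^o) (a : K).

Definition op_inverse T S := cancel T S /\ cancel S T.

Definition invertible T := exists S, op_inverse T S.

Definition is_projection P := forall x, P (P x) = P x.

Definition ker (L : B -> B) : set B := [set x | L x = 0].

(* For a linear subspace V of a linear subspace W: dim (W / V) = n, a basis of
   the quotient being represented by e. *)
Definition quotient_dim (W V : set B) (n : nat) :=
  exists e : 'I_n -> B, (forall i, W (e i)) /\
    (forall x, W x ->
       exists! c : 'rV[K]_n, V (x - \sum_(i < n) c ord0 i *: e i)).

Definition dim_ker T (n : nat) := quotient_dim (ker T) [set 0] n.

Definition dim_coker T (n : nat) := quotient_dim setT (range T) n.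

Definition fredholm T :=
  (exists m, dim_ker T m) /\ (exists n, dim_coker T n).

Definition fredholm_index T (k : int) :=
  exists m n : nat, [/\ dim_ker T m, dim_coker T n & k = m%:Z - n%:Z].

(* f z = \sum_(j >= 0) (z - a) ^+ j *: c j on a disc centred at a, where the
   series converges in operator norm: ||f z - S_n|| <= e is spelled out as
   |(f z - S_n) x| <= e * |x| for all x. *)
Definition has_taylor_series f (c : nat -> bop B) a :=
  exists2 r : K, 0 < r & forall z : K, `|z - a| < r ->
    forall e : K, 0 < e -> \forall n \near \oo, forall x,
      `|f z x - \sum_(j < n) (z - a) ^+ j *: c j x| <= e * `|x|.

Definition analytic_at f a := exists c, has_taylor_series f c a.

Definition analytic_on U f := forall a, U a -> analytic_at f a.

Definition has_pole f a (d : nat) :=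
  (0 < d)%N /\ exists g : K -> bop B,
    [/\ analytic_at g a, ~ (g a =1 cst 0) &
        \forall z \near (a : K^o)^', forall x,
          f z x = (z - a) ^- d *: g z x].

Definition compl P (x : B) : B := x - P x.

(* Aq k is the Fredholm quotient of order k of A at z0, with respect to the
   projections P 1, P 2, ...; nothing is required of P 0. *)
Definition successive_factorization U (z0 : K) (A : K -> bop B)
    (P : nat -> bop B) (Aq : nat -> K -> bop B) :=
  (forall z, U z -> Aq 0%N z =1 A z) /\
  (forall k : nat, (0 < k)%N ->
    [/\ is_projection (P k),
        range (P k) = range (Aq k.-1 z0),
        analytic_on U (Aq k),
        forall z, U z -> fredholm_index (Aq k z) 0 &
        forall z, U z -> forall x,
          Aq k.-1 z x = P k (Aq k z x) + (z - z0) *: compl (P k) (Aq k z x)]).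

Definition diff_proj (P : nat -> bop B) (c : nat -> bop B) (j : nat) (x : B) :=
  P j.+1 (c j x) - P j (c j x).

Definition sum_of_sets (n : nat) (V : nat -> set B) : set B :=
  [set y | exists2 v : nat -> B, (forall j, (j < n)%N -> V j (v j)) &
                                 y = \sum_(j < n) v j].

End BoundedOperators.

(* Main.v *)
From HB Require Import structures.
Require Import Defs.
From mathcomp Require Import all_boot all_order all_algebra.
From mathcomp Require Import complex ring.
From mathcomp Require Import all_classical all_reals all_analysis.
Import Order.TTheory GRing.Theory Num.Theory.
Import numFieldNormedType.Exports.
Local Open Scope classical_set_scope.
Local Open Scope ring_scope.
Set Implicit Arguments.
Unset Strict Implicit.
Unset Printing Implicit Defensive.

(** Write w = z - z0, Q_k = I - P_k.  The range of P_d is the range of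
    A^[d-1](z0), so P_d <> I says that A^[d-1](z0) is not onto: condition (ii)
    holds.  The three other conditions are then established one by one rather
    than through a cycle of implications.

    For (iii) and (iv), nesting of the ranges gives P_k P_i = P_i for i <= k.
    Hence P_(j+1) - P_j kills ran P_i for 1 <= i <= j and passes through each
    factor P_i + w Q_i with i <= j as multiplication by w, so that
    (P_(j+1) - P_j) A(z) = w^j (P_(j+1) - P_j) A^[j](z) ([step_factor]).
    Reading off the coefficient of w^j ([taylor_coef_factor]),
    (P_(j+1) - P_j) A_j = P_(j+1) A^[j](z0) - P_j A^[j](z0)
                        = A^[j](z0) - A^[j-1](z0)   (with A^[-1] = 0),
    because P_(j+1) fixes ran A^[j](z0) and A^[j-1](z0) = P_j A^[j](z0).  These
    operators therefore telescope to the invertible operator A^[d](z0)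
    ([sum_diff_proj]), whatever the kernels of the P_k are: every y is the sum
    of the values (P_(j+1) - P_j) A_j x at the single point
    x = A^[d](z0)^-1 y, and a common kernel vector is killed by A^[d](z0).

    For (i), (P_k + w Q_k)(w P_k + Q_k) = w I, so A(z)^-1 = w^-d g(z) with
    g(z) = A^[d](z)^-1 (w P_d + Q_d) ... (w P_1 + Q_1)
    ([inverse_of_quotient]).  At z0 the product Q_d ... Q_1 collapses to Q_d,
    hence g(z0) = A^[d](z0)^-1 Q_d <> 0 and the order of the pole is exactly d.
    Analyticity of g rests on that of z |-> A^[d](z)^-1
    ([inverse_analytic]): the coefficients of the formal inverse power series
    grow at most geometrically, and since the pointwise inverses are known to
    exist it only remains to see that the partial sums converge to them. *)

(** * Bounded operators *)

Lemma bop_of_bounded (K : numFieldType) (B : normedModType K) (f : B -> B) :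
  linear f -> (exists2 k : K, 0 < k & forall x, `|f x| <= k * `|x|) ->
  {T : bop B | T =1 f}.
Proof.
move=> f_lin f_bd; apply: cid.
pose fL : {linear B -> B} := HB.pack f (GRing.isLinear.Build _ _ _ _ f f_lin).
suff fc : continuous fL by exists (Bop fc).
apply: bounded_linear_continuous; apply/linear_boundedP.
have [k k0 fk] := f_bd; exists k; split; first exact: gtr0_real.
by move=> r kr x; apply: le_trans (fk x) _; rewrite ler_wpM2r // ltW.
Qed.

Lemma bop_bounded (K : numFieldType) (B : normedModType K) (T : bop B) :
  exists2 k : K, 0 < k & forall x, `|T x| <= k * `|x|.
Proof.
have /linear_boundedP : bounded_near T (nbhs (0 : B)).
  by apply: continuous_linear_bounded; exact: bop_continuous.
by move=> /pinfty_ex_gt0 [k k0 Tk]; exists k.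
Qed.

Lemma bop_uniformly_bounded (K : numFieldType) (B : normedModType K)
    (c : nat -> bop B) (N : nat) :
  exists2 k : K, 0 < k & forall n x, (n < N)%N -> `|c n x| <= k * `|x|.
Proof.
elim: N => [|N [k k0 ck]]; first by exists 1.
have [k' k'0 ck'] := bop_bounded (c N).
exists (k + k'); first exact: addr_gt0.
move=> n x; rewrite ltnS leq_eqVlt => /orP[/eqP ->|nN].
  by apply: le_trans (ck' x) _; rewrite ler_wpM2r // lerDr ltW.
by apply: le_trans (ck n x nN) _; rewrite ler_wpM2r // lerDl ltW.
Qed.

Lemma ex_bop_comp (K : numFieldType) (B : normedModType K) (S T : bop B) :
  {C : bop B | C =1 S \o T}.
Proof.
apply: bop_of_bounded; first by move=> a x y /=; rewrite !linearP.
have [[s s0 Ss] [t t0 Tt]] := (bop_bounded S, bop_bounded T).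
exists (s * t) => [|x /=]; first exact: mulr_gt0.
by rewrite -mulrA; apply: le_trans (Ss _) _; rewrite ler_pM2l.
Qed.

Lemma ex_bop_add (K : numFieldType) (B : normedModType K) (S T : bop B) :
  {C : bop B | C =1 fun x => S x + T x}.
Proof.
apply: bop_of_bounded.
  by move=> a x y /=; rewrite !linearP scalerDr addrACA.
have [[s s0 Ss] [t t0 Tt]] := (bop_bounded S, bop_bounded T).
exists (s + t) => [|x /=]; first exact: addr_gt0.
by rewrite mulrDl; apply: le_trans (ler_normD _ _) _; exact: lerD.
Qed.

Lemma ex_bop_scale (K : numFieldType) (B : normedModType K) (w : K)
    (T : bop B) :
  {C : bop B | C =1 fun x => w *: T x}.
Proof.
apply: bop_of_bounded.
  by move=> a x y /=; rewrite linearP scalerDr !scalerA mulrC.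
have [t t0 Tt] := bop_bounded T.
exists (`|w| * t + 1) => [|x].
  by rewrite ltr_wpDl // mulr_ge0 // ltW.
rewrite normrZ mulrDl mul1r -mulrA.
by apply: le_trans (_ : `|w| * (t * `|x|) <= _); rewrite ?ler_wpM2l ?lerDl.
Qed.

Lemma ex_bop_id (K : numFieldType) (B : normedModType K) : {C : bop B | C =1 id}.
Proof.
apply: bop_of_bounded => //; by exists 1 => // x; rewrite mul1r.
Qed.

Definition bop_comp (K : numFieldType) (B : normedModType K) (S T : bop B) :=
  sval (ex_bop_comp S T).
Definition bop_add (K : numFieldType) (B : normedModType K) (S T : bop B) :=
  sval (ex_bop_add S T).
Definition bop_scale (K : numFieldType) (B : normedModType K) (w : K)
  (T : bop B) := sval (ex_bop_scale w T).
Definition bop_id (K : numFieldType) (B : normedModType K) :=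
  sval (ex_bop_id B).

(** The operations on bounded operators are obtained by choice, hence opaque;
    these equations are their working definitions. *)
Lemma bopE (K : numFieldType) (B : normedModType K) :
  ((forall (S T : bop B) x, bop_comp S T x = S (T x)) *
  (forall (S T : bop B) x, bop_add S T x = (S x + T x)%R) *
  (forall w (T : bop B) x, bop_scale w T x = (w *: T x)%R) *
  (forall x, bop_id B x = x))%type.
Proof.
split; [split; [split|]|] => [S T x|S T x|w T x|x].
- by rewrite /bop_comp; case: (ex_bop_comp S T).
- by rewrite /bop_add; case: (ex_bop_add S T).
- by rewrite /bop_scale; case: (ex_bop_scale w T).
- by rewrite /bop_id; case: (ex_bop_id B).
Qed.

(** * Estimates on Taylor series *)

Lemma sum_geometric_le2 (K : numFieldType) (t : K) (n : nat) :
  0 <= t -> t <= 2^-1 -> \sum_(i < n) t ^+ i <= 2.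
Proof.
move=> t0 t2; elim: n => [|n IHn]; first by rewrite big_ord0.
rewrite big_ord_recl expr0 -[leRHS]/(1 + 1) lerD2l.
under eq_bigr do rewrite exprS.
rewrite -mulr_sumr; apply: le_trans (ler_pM t0 _ t2 IHn) _.
  by apply: sumr_ge0 => i _; rewrite exprn_ge0.
by rewrite mulVf.
Qed.

(** Cauchy estimates by elementary means: at a point at distance rho = r / 2 of
    the centre two consecutive partial sums eventually differ by at most
    2 |x|, uniformly in x, which bounds |c n| by a multiple of rho^-n.  The
    remainders are then dominated by a geometric series. *)
Lemma taylor_estimates (K : numFieldType) (B : normedModType K)
    (f : K -> bop B) (c : nat -> bop B) (a : K) :
  has_taylor_series f c a ->
  exists M q : K, [/\ 0 < M, 0 < q,
    forall n x, `|c n x| <= M * q ^+ n * `|x| &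
    forall z, q * `|z - a| <= 2^-1 -> forall m x,
      `|f z x - \sum_(j < m) (z - a) ^+ j *: c j x| <=
        2 * M * (q * `|z - a|) ^+ m * `|x|].
Proof.
move=> [r r0 fc]; pose rho := r / 2.
have rho0 : 0 < rho by rewrite divr_gt0.
have rhor : rho < r by rewrite ltr_pdivrMr // ltr_pMr // ltr1n.
have [|N _ fN] := fc (a + rho) _ 1 ltr01.
  by rewrite addrAC subrr add0r gtr0_norm.
have [k k0 ck] := bop_uniformly_bounded c N.
pose M := 2 + k * \sum_(i < N) rho ^+ i.
have sum_ge0 : 0 <= \sum_(i < N) rho ^+ i.
  by apply: sumr_ge0 => i _; rewrite exprn_ge0 // ltW.
have M0 : 0 < M by rewrite ltr_wpDr // mulr_ge0 // ltW.
have cM n x : `|c n x| <= M * rho^-1 ^+ n * `|x|.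
  rewrite -mulrA mulrCA exprVn ler_pdivlMl ?exprn_gt0 //.
  have [nN|Nn] := ltnP n N.
    apply: le_trans (_ : rho ^+ n * (k * `|x|) <= _).
      by rewrite ler_pM2l ?exprn_gt0 // ck.
    rewrite mulrCA mulrA ler_wpM2r //.
    apply: le_trans (_ : k * \sum_(i < N) rho ^+ i <= _); last by rewrite lerDr.
    rewrite ler_pM2l // (bigD1 (Ordinal nN)) //= lerDl.
    by apply: sumr_ge0 => i _; rewrite exprn_ge0 // ltW.
  have := lerD (fN n Nn x) (fN n.+1 (leqW Nn) x).
  rewrite big_ord_recr /= opprD addrA !mul1r => le2.
  have -> : rho ^+ n * `|c n x| = `|(a + rho - a) ^+ n *: c n x|.
    by rewrite addrAC subrr add0r normrZ normrX gtr0_norm.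
  move: (\sum_(i < n) _) le2 => s le2.
  have -> : (a + rho - a) ^+ n *: c n x = (f (a + rho) x - s) -
     (f (a + rho) x - s - (a + rho - a) ^+ n *: c n x) by rewrite subKr.
  apply: le_trans (ler_normB _ _) _; apply: le_trans le2 _.
  by rewrite -mulr2n -mulr_natl ler_wpM2r // lerDl mulr_ge0 // ltW.
exists M, rho^-1; split => //; first by rewrite invr_gt0.
move=> z zq m x.
have zr : `|z - a| < r.
  apply: le_lt_trans rhor; rewrite mulrC ler_pdivrMr // in zq.
  by apply: le_trans zq _; rewrite ger_pMl // invf_le1 // ler1n.
set t := rho^-1 * `|z - a| in zq *.
have t0 : 0 <= t by rewrite mulr_ge0 // invr_ge0 ltW.
apply/ler_addgt0Pr => e e0.
have e'0 : 0 < e / (`|x| + 1) by rewrite divr_gt0 // ltr_wpDl.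
have [n _ fn] := fc z zr _ e'0.
have := fn (m + n)%N (leq_addl _ _) x.
rewrite big_split_ord /= opprD addrA.
set u := _ - \sum_(i < m) _; set v := \sum_(i < n) _ => uv.
rewrite -[u](subrK v); apply: le_trans (ler_normD _ _) _; rewrite addrC lerD //.
  apply: le_trans (ler_norm_sum _ _ _) _.
  apply: le_trans (_ : \sum_(i < n) M * t ^+ m * `|x| * t ^+ i <= _).
    apply: ler_sum => i _; rewrite normrZ normrX.
    apply: le_trans (ler_wpM2l _ (cM _ _)) _; first by rewrite exprn_ge0.
    rewrite /t !exprMn !exprD le_eqVlt; apply/orP; left; apply/eqP; ring.
  rewrite -mulr_sumr [leRHS](_ : _ = M * t ^+ m * `|x| * 2); last by ring.
  by rewrite ler_wpM2l ?sum_geometric_le2 // !mulr_ge0 ?exprn_ge0 // ltW.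
apply: le_trans uv _; rewrite mulrAC ler_pdivrMr ?ltr_wpDl //.
by rewrite ler_pM2l // lerDl.
Qed.

Lemma taylor_coef0 (K : numFieldType) (B : normedModType K)
    (f : K -> bop B) (c : nat -> bop B) (a : K) :
  has_taylor_series f c a -> c 0%N =1 f a.
Proof.
move=> /taylor_estimates[M [q [_ _ _ fc]]] x.
apply/esym/eqP; rewrite -subr_eq0 -normr_le0.
have := fc a _ 1%N x; rewrite subrr normr0 mulr0 big_ord1 expr0 scale1r.
by rewrite expr1 mulr0 mul0r; apply; rewrite invr_ge0.
Qed.

Lemma ex_lower_bound_gt0 (K : numFieldType) (r s : K) : 0 < r -> 0 < s ->
  exists2 t, 0 < t & (t <= r) && (t <= s).
Proof.
move=> r0 s0; have [rs|/ltW sr] := real_leP (gtr0_real r0) (gtr0_real s0).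
  by exists r; rewrite // lexx.
by exists s; rewrite // lexx sr.
Qed.

(** Letting w tend to 0 gives b 0 = 0; then one factor w cancels on both sides
    and the remaining coefficients are treated inductively. *)
Lemma small_poly_eq0 (K : numFieldType) (B : normedModType K) (b : nat -> B)
    (n : nat) (r k : K) : 0 < r -> 0 < k ->
  (forall w, w != 0 -> `|w| <= r ->
     `|\sum_(i < n) w ^+ i *: b i| <= k * `|w| ^+ n) ->
  forall i, (i < n)%N -> b i = 0.
Proof.
move=> r0 k0; elim: n b => // n IHn b b_small.
suff b0 : b 0%N = 0.
  move=> [//|i]; rewrite ltnS; apply: (IHn (fun i => b i.+1)) => w w0 wr.
  rewrite -(ler_pM2l (_ : 0 < `|w|)) ?normr_gt0 // mulrCA -exprS -normrZ.
  apply: le_trans (b_small w w0 wr); rewrite big_ord_recl b0 scaler0 add0r.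
  by rewrite scaler_sumr; under eq_bigr do rewrite scalerA -exprS.
apply/eqP; rewrite -normr_le0; apply/ler_addgt0Pr => e e0.
pose s := \sum_(i < n) `|b i.+1|.
have s0 : 0 <= s by exact: sumr_ge0.
have ks0 : 0 < k + s by rewrite ltr_wpDr.
have [t1 t10 /andP[t1r t1e]] := ex_lower_bound_gt0 r0 (divr_gt0 e0 ks0).
have [w w0 /andP[wt1 w1]] := ex_lower_bound_gt0 t10 ltr01.
have wn : `|w| = w by rewrite gtr0_norm.
have := b_small w (lt0r_neq0 w0) _; rewrite wn => /(_ (le_trans wt1 t1r)).
rewrite big_ord_recl expr0 scale1r => bw.
rewrite add0r -[b 0%N](addrK (\sum_(i < n) w ^+ bump 0 i *: b (bump 0 i))).
apply: le_trans (ler_normB _ _) _.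
apply: le_trans (_ : w * (k + s) <= _); last first.
  by rewrite -ler_pdivlMr //; exact: le_trans t1e.
rewrite mulrDr; apply: lerD.
  apply: le_trans bw _; rewrite mulrC ler_pM2r // exprS ger_pMr //.
  by rewrite exprn_ile1 // ltW.
apply: le_trans (ler_norm_sum _ _ _) _; rewrite mulr_sumr.
apply: ler_sum => i _; rewrite normrZ normrX wn exprS -mulrA ler_pM2l //.
by rewrite ler_piMl // exprn_ile1 // ltW.
Qed.

(** Uniqueness of Taylor coefficients, in the only form needed to read off the
    coefficient of (z - a)^j: the j-th Taylor polynomials of both sides differ
    by O(|z - a|^(j + 1)), so [small_poly_eq0] identifies their
    coefficients. *)
Lemma taylor_coef_factor (K : numFieldType) (B : normedModType K)
    (f h : K -> bop B) (c : nat -> bop B) (a r : K) (L : bop B) (j : nat) :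
  has_taylor_series f c a -> analytic_at h a -> 0 < r ->
  (forall z, `|z - a| < r ->
     forall x, L (f z x) = (z - a) ^+ j *: L (h z x)) ->
  forall x, L (c j x) = L (h a x).
Proof.
move=> /taylor_estimates[M [q [M0 q0 _ fc]]].
move=> [c' hc'_series] r0 Lfh x.
have ha : h a x = c' 0%N x by rewrite (taylor_coef0 hc'_series).
have [M' [q' [M'0 q'0 _ hc']]] := taylor_estimates hc'_series.
have [l l0 Ll] := bop_bounded L.
pose b i := L (c i x) - (i == j)%:R *: L (h a x).
suff : b j = 0 by rewrite /b eqxx scale1r => /eqP; rewrite subr_eq0 => /eqP.
have r20 : 0 < r / 2 by rewrite divr_gt0.
have [t t0 /andP[tq tq']] :
    exists2 t, 0 < t & (t <= 2^-1 / q) && (t <= 2^-1 / q').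
  by apply: ex_lower_bound_gt0; rewrite divr_gt0 // invr_gt0.
have [s s0 /andP[sr st]] := ex_lower_bound_gt0 r20 t0.
(* The + 1 makes k positive also when x = 0. *)
pose k := l * (2 * M * q ^+ j.+1 + 2 * M' * q') * (`|x| + 1).
have k0 : 0 < k.
  by rewrite !mulr_gt0 // ?addr_gt0 ?ltr_wpDl // !mulr_gt0 // exprn_gt0.
apply: (@small_poly_eq0 _ _ b j.+1 s k) => // w _ ws.
have wr : `|a + w - a| < r.
  rewrite addrAC subrr add0r; apply: le_lt_trans ws _; apply: le_lt_trans sr _.
  by rewrite ltr_pdivrMr // ltr_pMr // ltr1n.
have wq : q * `|a + w - a| <= 2^-1.
  rewrite addrAC subrr add0r mulrC -ler_pdivlMr //.
  by apply: le_trans tq; exact: le_trans st.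
have wq' : q' * `|a + w - a| <= 2^-1.
  rewrite addrAC subrr add0r mulrC -ler_pdivlMr //.
  by apply: le_trans tq'; exact: le_trans st.
have := hc' _ wq' 1%N x; have := fc _ wq j.+1 x; have := Lfh _ wr x.
rewrite !big_ord1 expr0 scale1r expr1 -ha addrAC subrr add0r => Lw fw hw.
have -> : \sum_(i < j.+1) w ^+ i *: b i =
    w ^+ j *: L (h (a + w) x - h a x) -
    L (f (a + w) x - \sum_(i < j.+1) w ^+ i *: c i x).
  rewrite !(linearB (bop_fun L)) /= Lw linear_sum /= scalerBr opprB.
  rewrite [RHS]addrC addrA subrK.
  rewrite /b; under eq_bigr do rewrite scalerBr.
  rewrite sumrB; congr (_ - _).
    by apply: eq_bigr => i _; rewrite linearZ.
  rewrite big_ord_recr /= eqxx scale1r big1 ?add0r // => i _.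
  by rewrite ltn_eqF // scale0r scaler0.
apply: le_trans (ler_normB _ _) _; rewrite normrZ normrX.
have l_ge0 := ltW l0; have wj0 : 0 <= `|w| ^+ j by rewrite exprn_ge0.
apply: le_trans (lerD (ler_wpM2l wj0 (le_trans (Ll _) (ler_wpM2l l_ge0 hw)))
  (le_trans (Ll _) (ler_wpM2l l_ge0 fw))) _.
rewrite [leLHS](_ : _ =
  l * (2 * M * q ^+ j.+1 + 2 * M' * q') * `|x| * `|w| ^+ j.+1).
  rewrite /k ler_wpM2r ?exprn_ge0 // ler_wpM2l ?lerDl //.
  by rewrite !mulr_ge0 ?addr_ge0 // ?mulr_ge0 ?exprn_ge0 // ltW.
by rewrite exprMn !exprS; ring.
Qed.

(** * Inversion of analytic operator functions *)

(** n 4^-n <= 2^-n, as n < 2^n.  The scalars are complex, and their order is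
    compared with that of the real numbers, which is archimedean. *)
Lemma linear_geometric_near0 (R : realType) (t e : R[i]) :
  0 <= t -> t <= 4^-1 -> 0 < e -> \forall n \near \oo, n%:R * t ^+ n <= e.
Proof.
move=> t0 t4 e0.
have [r r0 er] : exists2 r : R, 0 < r & e = r%:C%C.
  case: e e0 => a b; rewrite ltcE /= => /andP[/eqP -> a0].
  by exists a.
have [N _ rN] := near_infty_natSinv_expn_lt (PosNum r0).
exists N => // n /rN /= /ltW; rewrite div1r -lecR -er => rn; apply: le_trans rn.
rewrite fmorphV rmorphXn rmorphD rmorph1 /= -[X in _ <= X]div1r.
rewrite ler_pdivlMr ?exprn_gt0 //.
rewrite -mulrA -exprMn.
have tn2 : (t * (1 + 1)) ^+ n <= 2^-1 ^+ n.
  apply: lerXn2r; rewrite ?nnegrE ?mulr_ge0 ?invr_ge0 //.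
  by rewrite -[1 + 1]/2%:R -ler_pdivlMr // -invfM -natrM.
apply: le_trans (ler_wpM2l _ tn2) _ => //.
rewrite exprVn ler_pdivrMr ?exprn_gt0 // mul1r -natrX ler_nat.
by rewrite ltnW // ltn_expl.
Qed.

(** Recursion on all previous values, passed as a list. *)
Lemma course_of_values (T : Type) (F : seq T -> T) :
  {u : nat -> T | forall n, u n = F (mkseq u n)}.
Proof.
pose fix prefix n := if n is m.+1 then rcons (prefix m) (F (prefix m)) else [::].
exists (fun n => F (prefix n)) => n; congr F.
by elim: n => // n IHn; rewrite mkseqS -IHn.
Qed.

Lemma ex_bop_sum (K : numFieldType) (B : normedModType K) (T : nat -> bop B)
    (n : nat) :
  {C : bop B | C =1 fun x => \sum_(i < n) T i x}.
Proof.
elim: n => [|n [C CE]].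
  exists (bop_scale 0 (bop_id B)) => x.
  by rewrite big_ord0 bopE scale0r.
by exists (bop_add C (T n)) => x; rewrite bopE CE big_ord_recr.
Qed.

Definition bop_sum (K : numFieldType) (B : normedModType K) (T : nat -> bop B)
  (n : nat) := sval (ex_bop_sum T n).

Lemma bop_sumE (K : numFieldType) (B : normedModType K) (T : nat -> bop B)
    (n : nat) : bop_sum T n =1 fun x => \sum_(i < n) T i x.
Proof. by rewrite /bop_sum; case: (ex_bop_sum T n). Qed.

(** The formal inverse of sum_n w^n c_n when S is a right inverse of c_0: the
    Cauchy product formula sum_(j <= n) c_(n-j) D_j = delta_(n,0) is solved for
    D_n. *)
Lemma ex_inverse_coef (K : numFieldType) (B : normedModType K)
    (c : nat -> bop B) (S : bop B) :
  cancel S (c 0%N) ->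
  exists D : nat -> bop B,
    (forall n x, D n x =
       S ((n == 0%N)%:R *: x - \sum_(j < n) c (n - j)%N (D j x))) /\
    (forall n x, \sum_(j < n.+1) c (n - j)%N (D j x) = (n == 0%N)%:R *: x).
Proof.
move=> cS.
pose F (s : seq (bop B)) : bop B :=
  bop_comp S (bop_add (bop_scale (nilp s)%:R (bop_id B))
    (bop_scale (-1)
       (bop_sum (fun j => bop_comp (c (size s - j)%N) (nth S s j)) (size s)))).
have [D DF] := course_of_values F; exists D.
have DE n x : D n x = S ((n == 0%N)%:R *: x - \sum_(j < n) c (n - j)%N (D j x)).
  rewrite DF /F !bopE bop_sumE /nilp size_mkseq scaleN1r.
  congr (S (_ - _)); apply: eq_bigr => j _.
  by rewrite !bopE nth_mkseq.
split=> // n x; rewrite big_ord_recr /= subnn DE cS.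
by rewrite addrC subrK.
Qed.

(** With p = q (1 + s M) the recursion reproduces the bound s p^n exactly: since
    p - q = s M q, the sum of s M q^(n-j) p^j over j < n is p^n - q^n. *)
Lemma inverse_coef_bound (K : numFieldType) (B : normedModType K)
    (c D : nat -> bop B) (S : bop B) (M q s : K) :
  0 < M -> 0 < q -> 0 < s ->
  (forall n x, `|c n x| <= M * q ^+ n * `|x|) ->
  (forall x, `|S x| <= s * `|x|) ->
  (forall n x, D n x =
     S ((n == 0%N)%:R *: x - \sum_(j < n) c (n - j)%N (D j x))) ->
  forall n x, `|D n x| <= s * (q * (1 + s * M)) ^+ n * `|x|.
Proof.
move=> M0 q0 s0 cM Ss DE; set p := q * _.
have p0 : 0 < p by rewrite mulr_gt0 // ltr_wpDr // mulr_ge0 // ltW.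
elim/ltn_ind => n IHn x; rewrite DE.
apply: le_trans (Ss _) _; rewrite -mulrA ler_pM2l //.
apply: le_trans (ler_normB _ _) _.
apply: le_trans (_ : (n == 0%N)%:R * `|x| +
    (\sum_(j < n) M * q ^+ (n - j) * (s * p ^+ j)) * `|x| <= _).
  apply: lerD; first by rewrite normrZ normr_nat.
  apply: le_trans (ler_norm_sum _ _ _) _; rewrite mulr_suml.
  apply: ler_sum => j _; apply: le_trans (cM _ _) _; rewrite -[leRHS]mulrA.
  by rewrite ler_pM2l ?IHn // mulr_gt0 // exprn_gt0.
rewrite -mulrDl ler_wpM2r //.
rewrite (_ : \sum_(j < n) _ = p ^+ n - q ^+ n).
  case: n {IHn} => [|n]; rewrite ?expr0 ?subrr ?addr0 // add0r gerBl.
  by rewrite exprn_ge0 // ltW.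
rewrite -opprB subrXX (_ : q - p = - (s * M * q)); last by rewrite /p; ring.
rewrite mulNr opprK mulr_sumr; apply: eq_bigr => j _.
rewrite (_ : (n - j = (n.-1 - j).+1)%N) ?exprS; first by ring.
by case: n j {IHn} => [[]//|n] j; rewrite subSn // -ltnS.
Qed.

(** Grouping the product triangularly, so that the total degree stays at most
    n, leaves no error term. *)
Lemma inverse_partial_sums (K : numFieldType) (B : normedModType K)
    (c D : nat -> bop B) (w : K) (n : nat) (x : B) :
  (forall n x, \sum_(j < n.+1) c (n - j)%N (D j x) = (n == 0%N)%:R *: x) ->
  \sum_(j < n.+1) w ^+ j *: (\sum_(i < n.+1 - j) w ^+ i *: c i (D j x)) = x.
Proof.
move=> cD; pose Q m := \sum_(j < m) w ^+ j *:
  (\sum_(i < m - j) w ^+ i *: c i (D j x)).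
have QS m : Q m.+1 = Q m + w ^+ m *: ((m == 0%N)%:R *: x).
  transitivity (\sum_(j < m.+1)
      (w ^+ j *: (\sum_(i < m - j) w ^+ i *: c i (D j x)) + w ^+ m *: c (m - j)%N (D j x))).
    apply: eq_bigr => j _; have jm : (j <= m)%N by rewrite -ltnS.
    by rewrite subSn // big_ord_recr scalerDr scalerA -exprD subnKC.
  rewrite big_split -scaler_sumr cD big_ord_recr /= subnn big_ord0 scaler0.
  by rewrite addr0.
rewrite -/(Q n.+1); elim: n => [|n IHn].
  by rewrite QS /Q big_ord0 add0r expr0 !scale1r.
by rewrite QS IHn scale0r scaler0 addr0.
Qed.

(** Let T_n be the partial sum of the formal inverse series.  Then
    g(z) - T_n = g(z) (I - f(z) T_n), and by
    [inverse_partial_sums] I - f(z) T_n only involves remainders of the series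
    of f, of total size O(n t^n) with t = p |z - a|.  At a fixed z the operator
    g(z) is merely some bounded operator, which is enough. *)
Lemma inverse_analytic (R : realType) (B : normedModType R[i])
    (f g : R[i] -> bop B) (a r : R[i]) :
  0 < r -> analytic_at f a ->
  (forall z, `|z - a| < r -> op_inverse (f z) (g z)) -> analytic_at g a.
Proof.
move=> r0 [c fc] fg.
have ga_inv : cancel (g a) (c 0%N).
  move=> x; rewrite (taylor_coef0 fc).
  have [_ gK] : op_inverse (f a) (g a) by apply: fg; rewrite subrr normr0.
  by rewrite gK.
have [M [q [M0 q0 cM fcM]]] := taylor_estimates fc.
have [s s0 Ss] := bop_bounded (g a).
have [D [DE cD]] := ex_inverse_coef ga_inv.
have := inverse_coef_bound M0 q0 s0 cM Ss DE; set p := q * _ => Ds.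
have sM0 : 0 < s * M by rewrite mulr_gt0.
have p0 : 0 < p by rewrite mulr_gt0 // ltr_wpDr // ltW.
have qp : q <= p by rewrite ler_pMr // lerDl ltW.
have p4 : 0 < 4^-1 / p by rewrite divr_gt0 ?invr_gt0.
have [rho rho0 /andP[rhor rhop]] := ex_lower_bound_gt0 r0 p4.
exists D, rho => // z zrho e e0.
have [G G0 gG] := bop_bounded (g z).
set t := p * `|z - a|.
have t0 : 0 <= t by rewrite mulr_ge0 // ltW.
have t4 : t <= 4^-1.
  by rewrite /t mulrC -ler_pdivlMr // (le_trans (ltW zrho)).
have qt : q * `|z - a| <= t by rewrite ler_wpM2r.
have q2 : q * `|z - a| <= 2^-1.
  by apply: le_trans (le_trans qt t4) _; rewrite lef_pV2 ?posrE // ler_nat.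
have e'0 : 0 < e / (G * (2 * M * s)) by rewrite divr_gt0 // !mulr_gt0.
have [N _ tN] := linear_geometric_near0 t0 t4 e'0.
exists N.+1 => // -[//|n] /= Nn x.
have [gf _] := fg z (lt_le_trans zrho rhor).
set T := \sum_(j < n.+1) _.
rewrite -[T]gf -linearB; apply: le_trans (gG _) _.
have -> : x - f z T = - \sum_(j < n.+1) (z - a) ^+ j *:
    (f z (D j x) - \sum_(i < n.+1 - j) (z - a) ^+ i *: c i (D j x)).
  under eq_bigr do rewrite scalerBr.
  rewrite sumrB (inverse_partial_sums _ _ _ cD) opprB; congr (_ - _).
  by rewrite linear_sum; apply: eq_bigr => j _; rewrite linearZ.
rewrite normrN -ler_pdivlMl //.
apply: le_trans (ler_norm_sum _ _ _) _.
apply: le_trans (_ : \sum_(j < n.+1) 2 * M * s * t ^+ n.+1 * `|x| <= _).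
  apply: ler_sum => j _; rewrite normrZ normrX.
  have M2 : 0 <= 2 * M by rewrite mulr_ge0 // ltW.
  have tq0 : 0 <= q * `|z - a| by rewrite mulr_ge0 // ltW.
  apply: le_trans (ler_wpM2l _ (fcM z q2 _ _)) _; first exact: exprn_ge0.
  apply: le_trans (_ : `|z - a| ^+ j * (2 * M * t ^+ (n.+1 - j) *
      (s * p ^+ j * `|x|)) <= _).
    apply: ler_wpM2l; first exact: exprn_ge0.
    apply: ler_pM => //; first by apply: mulr_ge0; rewrite ?exprn_ge0.
    by rewrite ler_wpM2l // lerXn2r // nnegrE.
  rewrite -[in leRHS](subnKC (ltnW (ltn_ord j))) exprD.
  rewrite /t !exprMn le_eqVlt; apply/orP; left; apply/eqP.
  ring.
rewrite sumr_const card_ord -[X in X <= _]mulr_natl.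
have := tN _ (ltnW Nn).
rewrite ler_pdivlMr ?mulr_gt0 // => tN'.
rewrite ler_pdivlMl // !mulrA; apply: ler_wpM2r => //.
by apply: le_trans tN'; rewrite le_eqVlt; apply/orP; left; apply/eqP; ring.
Qed.

(** * Factors attached to a projection *)

(** u P + v (I - P): for the projection P_k both the factor P_k + w Q_k
    (u = 1, v = w) and its complementary factor w P_k + Q_k (u = w, v = 1) have
    this form, and such operators multiply componentwise ([weightedM]). *)
Definition weighted (K : numFieldType) (B : normedModType K) (P : bop B)
    (u v : K) : bop B :=
  bop_add (bop_scale u P)
    (bop_scale v (bop_add (bop_id B) (bop_scale (-1) P))).

Lemma weightedE (K : numFieldType) (B : normedModType K) (P : bop B)
    (u v : K) (x : B) : weighted P u v x = u *: P x + v *: compl P x.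
Proof. by rewrite /weighted !bopE scaleN1r. Qed.

Lemma projectionM (K : numFieldType) (B : normedModType K) (P : bop B) (x : B) :
  is_projection P -> range P x -> P x = x.
Proof. by move=> PP [y _ <-]; exact: PP. Qed.

Lemma weightedM (K : numFieldType) (B : normedModType K) (P : bop B)
    (u v u' v' : K) (x : B) : is_projection P ->
  weighted P u v (weighted P u' v' x) = weighted P (u * u') (v * v') x.
Proof.
move=> PP; have PQ y : P (compl P y) = 0 by rewrite /compl linearB PP subrr.
set y := weighted P u' v' x.
have Py : P y = u' *: P x.
  by rewrite /y weightedE linearD !linearZ /= PQ PP scaler0 addr0.
have Qy : compl P y = v' *: compl P x.
  by rewrite {1}/compl Py /y weightedE addrC addKr.
by rewrite !weightedE Py Qy !scalerA.
Qed.

Lemma weighted_cst (K : numFieldType) (B : normedModType K) (P : bop B)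
    (u : K) (x : B) : weighted P u u x = u *: x.
Proof. by rewrite weightedE -scalerDr /compl addrC subrK. Qed.

(** Composing with w P + (I - P) shifts the part of the series seen through P by
    one degree, which explains the coefficients c'. *)
Lemma analytic_comp_weighted (K : numFieldType) (B : normedModType K)
    (f : K -> bop B) (a : K) (P : bop B) :
  analytic_at f a ->
  analytic_at (fun z => bop_comp (f z) (weighted P (z - a) 1)) a.
Proof.
move=> [c [r r0 fc]].
have [k k0 Pk] := bop_bounded P.
pose c' n := if n is m.+1 then bop_add (bop_comp (c m) P)
  (bop_comp (c m.+1) (weighted P 0 1)) else bop_comp (c 0%N) (weighted P 0 1).
have [l l0 Ql] := bop_bounded (weighted P 0 1).
exists c', r => // z zr e e0.
have rk0 : 0 < r * k + l by rewrite addr_gt0 ?mulr_gt0.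
have [N _ fN] := fc z zr _ (divr_gt0 e0 rk0).
exists N.+1 => // -[//|n] /= Nn x.
have -> : \sum_(j < n.+1) (z - a) ^+ j *: c' j x =
    (z - a) *: (\sum_(j < n) (z - a) ^+ j *: c j (P x)) +
    \sum_(j < n.+1) (z - a) ^+ j *: c j (weighted P 0 1 x).
  rewrite big_ord_recl [in RHS]big_ord_recl /= bopE addrCA; congr (_ + _).
  rewrite scaler_sumr -big_split; apply: eq_bigr => j _ /=.
  by rewrite !bopE scalerDr scalerA -exprS.
rewrite bopE; have -> : f z (weighted P (z - a) 1 x) =
    (z - a) *: f z (P x) + f z (weighted P 0 1 x).
  by rewrite !weightedE scale0r add0r linearD linearZ.
rewrite opprD addrACA -scalerBr.
have ek0 : 0 <= e / (r * k + l) by rewrite divr_ge0 // ltW.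
apply: le_trans (ler_normD _ _) _; rewrite normrZ.
apply: le_trans (_ : r * (e / (r * k + l) * (k * `|x|)) +
  e / (r * k + l) * (l * `|x|) <= _).
  apply: lerD; last by apply: le_trans (fN _ (ltnW Nn) _) _; exact: ler_wpM2l.
  apply: ler_pM => //; first exact: ltW.
  by apply: le_trans (fN _ Nn _) _; exact: ler_wpM2l.
rewrite le_eqVlt; apply/orP; left; apply/eqP; field.
by rewrite lt0r_neq0.
Qed.

(** The factor P + w (I - P) is inverted by P + w^-1 (I - P). *)
Lemma op_inverse_factor (K : numFieldType) (B : normedModType K)
    (P T h : bop B) (w : K) :
  is_projection P -> w != 0 -> (forall x, T x = weighted P 1 w (h x)) ->
  invertible T -> invertible h.
Proof.
move=> PP w0 Th [S [TS ST]]; exists (bop_comp S (weighted P 1 w)).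
have wK x : weighted P 1 w^-1 (weighted P 1 w x) = x.
  by rewrite weightedM // mulr1 mulVf // weighted_cst scale1r.
split=> x; rewrite bopE; first by rewrite -Th TS.
by rewrite -[LHS]wK -Th ST wK.
Qed.

Lemma nested_ranges (K : numFieldType) (B : normedModType K)
    (P : nat -> bop B) (d : nat) :
  (forall k, (0 < k < d)%N -> range (P k) `<=` range (P k.+1)) ->
  forall i j, (0 < i <= j)%N -> (j <= d)%N -> range (P i) `<=` range (P j).
Proof.
move=> Ple i j /andP[i0]; elim: j => [|j IHj]; first by rewrite leqNgt i0.
rewrite leq_eqVlt => /predU1P[<- _|]; [exact: subset_refl|rewrite ltnS => ij jd].
apply: subset_trans (IHj ij (ltnW jd)) (Ple j _).
by rewrite jd (leq_trans i0).
Qed.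

Lemma open_ball_in (K : numFieldType) (U : set K^o) (a : K) :
  open U -> U a -> exists2 r : K, 0 < r & forall z, `|z - a| < r -> U z.
Proof.
move=> Uo Ua; have /nbhs_ballP[r r0 rU] : nbhs (a : K^o) U.
  exact: open_nbhs_nbhs.
by exists r => // z zr; apply: rU; rewrite -ball_normE /= distrC.
Qed.

Section Factorization.
Variables (K : numFieldType) (B : normedModType K).
Variables (U : set K^o) (z0 : K) (A : K -> bop B).
Variables (P : nat -> bop B) (Aq : nat -> K -> bop B) (d : nat).
Hypothesis Uz0 : U z0.
Hypothesis fact : successive_factorization U z0 A P Aq.
Hypothesis P_nested :
  forall k, (0 < k < d)%N -> range (P k) `<=` range (P k.+1).

Let Pproj k : (0 < k)%N -> is_projection (P k).
Proof. by case: fact => _ /[apply] -[]. Qed.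

Lemma factorE k z x : U z ->
  Aq k z x = weighted (P k.+1) 1 (z - z0) (Aq k.+1 z x).
Proof.
move=> Uz; case: fact => _ /(_ k.+1 isT)[_ _ _ _ /(_ z Uz x) ->].
by rewrite weightedE scale1r.
Qed.

Lemma quotient_invertible k z : U z -> z <> z0 -> invertible (A z) ->
  invertible (Aq k z).
Proof.
move=> Uz zz0 Az; elim: k => [|k].
  have [+ _] := fact; move=> /(_ z Uz) AE.
  by case: Az => S [AS SA]; exists S; split=> x; rewrite AE.
apply: op_inverse_factor (Pproj (ltn0Sn k)) _ (fun x => factorE k x Uz).
by rewrite subr_eq0; apply/eqP.
Qed.

Lemma proj_fix i j x : (0 < i <= j)%N -> (j <= d)%N -> P j (P i x) = P i x.
Proof.
move=> ij jd; apply: projectionM; last first.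
  by apply: (nested_ranges P_nested ij jd); exists x.
by apply: Pproj; case/andP: ij; exact: leq_trans.
Qed.

(** Descending from A^[d] to A, each step composes the inverse on the right with
    w P_k + Q_k, at the cost of one power of w.  At z0 the first step
    contributes Q_d; the later ones contribute factors Q_k with k < d, which
    Q_d absorbs since Q_d P_k = 0. *)
Lemma inverse_of_quotient (G : K -> bop B) :
  (forall z, U z -> op_inverse (Aq d z) (G z)) -> analytic_at G z0 ->
  forall m, (m <= d)%N -> exists g : K -> bop B,
    [/\ analytic_at g z0,
        forall z, U z -> forall x, Aq (d - m)%N z (g z x) = (z - z0) ^+ m *: x,
        forall z, U z -> forall x, g z (Aq (d - m)%N z x) = (z - z0) ^+ m *: x &
        forall x, g z0 x = G z0 (if m is 0%N then x else compl (P d) x)].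
Proof.
move=> GA G_an; elim=> [|m IHm] md.
  exists G; split=> // z Uz x; rewrite subn0 scale1r; by case: (GA z Uz).
have [g [g_an Ag gA g0]] := IHm (ltnW md).
set k := (d - m.+1)%N; have kE : (d - m)%N = k.+1 by rewrite /k subnSK.
rewrite kE in Ag gA.
exists (fun z => bop_comp (g z) (weighted (P k.+1) (z - z0) 1)); split.
- exact: analytic_comp_weighted.
- move=> z Uz x; rewrite bopE factorE // Ag // linearZ /=.
  rewrite (weightedM _ _ _ _ _ (@Pproj k.+1 isT)).
  by rewrite mul1r mulr1 weighted_cst scalerA -exprSr.
- move=> z Uz x; rewrite bopE factorE //.
  rewrite (weightedM _ _ _ _ _ (@Pproj k.+1 isT)).
  by rewrite mul1r mulr1 weighted_cst linearZ /= gA // scalerA -exprS.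
- move=> x; rewrite bopE weightedE subrr scale0r add0r scale1r g0.
  case: m md {IHm Ag gA g0} @k kE => [|m] md k kE.
    by rewrite -kE subn0.
  have kd : (0 < k.+1 <= d)%N by rewrite -kE leq_subr kE.
  congr (G z0 _); rewrite /compl linearB /= proj_fix //.
  by rewrite opprB addrA subrK.
Qed.

Definition step j : bop B := bop_add (P j.+1) (bop_scale (-1) (P j)).

Lemma stepE j x : step j x = P j.+1 x - P j x.
Proof. by rewrite /step !bopE scaleN1r. Qed.

(** Both P_(j+1) and P_j fix the range of P_i. *)
Lemma step_proj i j x : P d.+1 =1 id -> (0 < i <= j)%N -> (j <= d)%N ->
  step j (P i x) = 0.
Proof.
move=> PSd ij jd; rewrite stepE (proj_fix _ ij jd).
have [jd'|dj] := ltnP j d.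
  by rewrite proj_fix ?subrr //; case/andP: ij => -> /leqW.
by rewrite (_ : j = d) ?PSd ?subrr //; apply/eqP; rewrite eqn_leq jd.
Qed.

(** By [step_proj], P_(j+1) - P_j sends (P_i + w Q_i) y to w times its value at
    y for i <= j, so peeling off the first j factors yields w^j. *)
Lemma step_factor j z x : (j <= d)%N -> P d.+1 =1 id -> U z ->
  step j (A z x) = (z - z0) ^+ j *: step j (Aq j z x).
Proof.
move=> jd PSd Uz; have [/(_ z Uz) <- _] := fact.
suff H i : (i <= j)%N ->
    step j (Aq 0%N z x) = (z - z0) ^+ i *: step j (Aq i z x) by exact: H.
elim: i => [|i IHi] ij; first by rewrite expr0 scale1r.
rewrite (IHi (ltnW ij)) (factorE i x Uz) weightedE scale1r linearD linearZ /=.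
by rewrite /compl linearB /= step_proj // add0r subr0 scalerA -exprSr.
Qed.

Lemma diff_projE (c : nat -> bop B) : open U -> has_taylor_series A c z0 ->
  P 0%N =1 cst 0 -> P d.+1 =1 id ->
  forall j, (j <= d)%N -> forall x, diff_proj P c j x =
    Aq j z0 x - (if j is i.+1 then Aq i z0 x else 0).
Proof.
move=> Uo Ac P0 PSd j jd x.
have PA i y : P i.+1 (Aq i z0 y) = Aq i z0 y.
  apply: projectionM; first exact: Pproj.
  by case: fact => _ /(_ i.+1 isT)[_ -> _ _ _]; exists y.
case: j jd => [|j] jd; rewrite /diff_proj.
  have [/(_ z0 Uz0) A0 _] := fact.
  by rewrite P0 (taylor_coef0 Ac) -A0 PA.
have PAj : P j.+1 (Aq j.+1 z0 x) = Aq j z0 x.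
  by rewrite (factorE j x Uz0) weightedE subrr scale0r addr0 scale1r.
rewrite -[in RHS]PAj -[X in _ = X - _]PA.
rewrite -!stepE.
have [r r0 rU] := open_ball_in Uo Uz0.
apply: (@taylor_coef_factor _ _ A (Aq j.+1) c z0 r (step j.+1)) => //.
  by case: fact => _ /(_ j.+1 isT)[_ _ + _ _]; apply.
by move=> z /rU Uz y; exact: step_factor.
Qed.

(** The telescoping sum behind both the range and the kernel condition. *)
Lemma sum_diff_proj (c : nat -> bop B) : open U -> has_taylor_series A c z0 ->
  P 0%N =1 cst 0 -> P d.+1 =1 id ->
  forall x, \sum_(j < d.+1) diff_proj P c j x = Aq d z0 x.
Proof.
move=> Uo Ac P0 PSd x.
suff H n : (n <= d)%N -> \sum_(j < n.+1) diff_proj P c j x = Aq n z0 x.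
  exact: H.
elim: n => [|n IHn] nd; rewrite big_ord_recr /= diff_projE //.
  by rewrite big_ord0 add0r subr0.
by rewrite IHn ?(ltnW nd) // addrC subrK.
Qed.
End Factorization.

(** * The equivalence *)

Lemma has_pole_inverse (R : realType) (B : normedModType R[i])
    (U : set (R[i])^o) (z0 : R[i]) (A : R[i] -> bop B) (P : nat -> bop B)
    (Aq : nat -> R[i] -> bop B) (d : nat) :
  open U -> U z0 ->
  (forall z, U z -> z <> z0 -> invertible (A z)) ->
  successive_factorization U z0 A P Aq -> (0 < d)%N -> invertible (Aq d z0) ->
  (forall k, (0 < k < d)%N -> range (P k) `<=` range (P k.+1)) ->
  ~ (P d =1 id) ->
  exists Ainv : R[i] -> bop B,
    (forall z, U z -> z <> z0 -> op_inverse (A z) (Ainv z)) /\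
    has_pole Ainv z0 d.
Proof.
move=> Uo Uz0 A_inv fact d0 Ad_inv P_nested Pd.
have [G GA] : exists G : R[i] -> bop B,
    forall z, U z -> op_inverse (Aq d z) (G z).
  suff /choice[G GA] : forall z, exists S, U z -> op_inverse (Aq d z) S.
    by exists G.
  move=> z.
  have [Uz|nUz] := pselect (U z); last by exists (A z).
  have [->|/eqP zz0] := eqVneq z z0; first by case: Ad_inv => S; exists S.
  have [S AS] := quotient_invertible fact d Uz zz0 (A_inv z Uz zz0).
  by exists S.
have [r r0 rU] := open_ball_in Uo Uz0.
have [_ /(_ d d0)[Pproj _ Ad_an _ _]] := fact.
have G_an : analytic_at G z0.
  apply: (inverse_analytic r0 (Ad_an _ Uz0)) => z zr; exact/GA/rU.
have [g [g_an Ag gA g0]] :=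
  inverse_of_quotient fact P_nested GA G_an (leqnn d).
rewrite subnn in Ag gA.
have A0 z : U z -> Aq 0%N z =1 A z by case: fact => + _; apply.
exists (fun z => bop_scale ((z - z0) ^- d) (g z)); split.
  move=> z Uz zz0.
  have wd0 : (z - z0) ^+ d != 0 by rewrite expf_neq0 // subr_eq0; apply/eqP.
  split=> x; rewrite bopE ?linearZ /= -A0 // ?gA ?Ag //.
    by rewrite scalerA mulVf // scale1r.
  by rewrite scalerA mulVf // scale1r.
split=> //; exists g; split=> //; last by apply: nearW => z x; rewrite bopE.
move=> g_eq0; apply: Pd => x; apply/esym/eqP; rewrite -subr_eq0; apply/eqP.
have [_ GK] := GA z0 Uz0.
rewrite -[LHS]GK; have := g_eq0 x; rewrite g0; case: (d) d0 => // d' _ ->.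
by rewrite linear0.
Qed.

Theorem proposition4 (R : realType) (B : completeNormedModType R[i])
    (U : set (R[i])^o) (z0 : R[i]) (A : R[i] -> bop B)
    (Acoef : nat -> bop B) (P : nat -> bop B) (Aq : nat -> R[i] -> bop B)
    (d : nat) :
  separable B ->
  open U -> connected U -> U z0 ->
  analytic_on U A ->
  (forall z, U z -> fredholm (A z)) ->
  (forall z, U z -> z <> z0 -> invertible (A z)) ->
  ~ invertible (A z0) ->
  has_taylor_series A Acoef z0 ->
  successive_factorization U z0 A P Aq ->
  (0 < d)%N ->
  invertible (Aq d z0) ->
  (forall k : nat, (0 < k < d)%N -> range (P k) `<=` range (P k.+1)) ->
  P 0%N =1 cst 0 ->
  ~ (P d =1 id) ->
  (forall j : nat, (0 < j)%N -> P (d + j)%N =1 id) ->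
  [<->
    (* (i) *)
    exists Ainv : R[i] -> bop B,
      (forall z, U z -> z <> z0 -> op_inverse (A z) (Ainv z)) /\
      has_pole Ainv z0 d;
    (* (ii) *)
    invertible (Aq d z0) /\ ~ invertible (Aq d.-1 z0);
    (* (iii) *)
    [/\ [set: B] =
          sum_of_sets d.+1 (fun j => range (diff_proj P Acoef j)),
        ~ (P d =1 id) & P d.+1 =1 id];
    (* (iv) *)
    [/\ [set 0] =
          \bigcap_(j < d.+1) ker (diff_proj P Acoef j),
        ~ (P d =1 id) & P d.+1 =1 id]].
Proof.
move=> _ Uo _ Uz0 _ _ A_inv _ Ac fact d0 Ad_inv P_nested P0 Pd PSd'.
have PSd : P d.+1 =1 id by rewrite -addn1; exact: PSd'.
have sumE := sum_diff_proj Uz0 fact P_nested Uo Ac P0 PSd.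
have c1 := has_pole_inverse Uo Uz0 A_inv fact d0 Ad_inv P_nested Pd.
have c2 : invertible (Aq d z0) /\ ~ invertible (Aq d.-1 z0).
  split=> // -[S [_ SK]]; apply: Pd => x.
  have [_ /(_ d d0)[Pproj PA _ _ _]] := fact.
  by apply: projectionM => //; rewrite PA; exists (S x).
have [S [AS SA]] := Ad_inv.
have c3 : [/\ [set: B] =
    sum_of_sets d.+1 (fun j => range (diff_proj P Acoef j)),
    ~ (P d =1 id) & P d.+1 =1 id].
  split=> //; apply/esym/seteqP; split=> // y _.
  exists (fun j => diff_proj P Acoef j (S y)); first by move=> j _; exists (S y).
  by rewrite sumE SA.
have c4 : [/\ [set 0] = \bigcap_(j < d.+1) ker (diff_proj P Acoef j),
    ~ (P d =1 id) & P d.+1 =1 id].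
  split=> //; apply/seteqP; split=> [x -> j _|x x_ker] /=.
    by rewrite /ker /diff_proj /= !linear0 addr0.
  by rewrite -[x]AS -sumE big1 ?linear0 // => j _; exact: x_ker _ (ltn_ord j).
by tfae.
Qed.
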